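(* Assume $L(z)$ is a quadratic function on extended phase space and the Poisson bracket $[L,\mathcal H]$ is identically equal to zero. Then $L$ is exactly conserved at the vertices of a regularized DTH trajectory: if $z_0,\dots,z_N$ are the vertices of a regularized DTH trajectory, then $L(z_{k+1})=L(z_k)$ for $k=0,\dots,N-1$.
   Context: Extended phase space is $\mathbb R^{2(n+1)}$ with points $z=(q,p)$, $q=(q_1,\dots,q_n,t)$, $p=(p_1,\dots,p_n,\wp)$. The extended-phase space Hamiltonian is $\mathcal H(z)=\wp+H(t,q_1,\dots,q_n,p_1,\dots,p_n)$, where $H$ is a sufficiently smooth ($C^3$) real function on an open set of $\mathbb R^{2n+1}$. $J=\begin{pmatrix}0&I\\-I&0\end{pmatrix}$ with $I$ the $(n+1)\times(n+1)$ identity; $\mathcal H_z$ is the gradient, $\mathcal H_{zz}$ the Hessian, and $\psi(z)=(J\mathcal H_z)^\top\mathcal H_{zz}(J\mathcal H_z)$. The Poisson bracket is $[F,G]=F_z^\top JG_z$. ''Quadratic function'' means a polynomial in $z$ of degree at most $2$ (linear and quadratic functions). A regularized DTH trajectory is (the piecewise-linear continuous trajectory with) vertices $z_0,\dots,z_N$ such that, with $\Delta z_k=z_{k+1}-z_k$ and $\overline z_k=\tfrac12(z_{k+1}+z_k)$ in the domain of $\mathcal H$, for each $k=0,\dots,N-1$ there are real $\lambda_k,\mu_k$ with \[\Delta z_k=\lambda_kJ\mathcal H_z(\overline z_k)+\mu_kJ\psi_z(\overline z_k),\quad \mathcal H(\overline z_k)=0,\quad \psi(\overline z_k)\ge\psi_k\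 (\text{or }\psi(\overline z_k)\le\psi_k),\] \[\mu_k(\psi(\overline z_k)-\psi_k)=0,\quad \mu_k\le0\ (\text{or }\mu_k\ge0),\] where the $\psi_k$ are given real constants and the choice of alternatives is given for each $k$ (first alternatives together, or second alternatives together). *)

(* Defs.v *)
From mathcomp Require Import all_boot all_order all_algebra.
From mathcomp Require Import all_classical all_reals all_analysis.
(* The notations of mpoly clash with those of mathcomp-analysis. *)
From mathcomp Require Import -(notations) mpoly.

Set Implicit Arguments.
Unset Strict Implicit.
Unset Printing Implicit Defensive.
Import Order.TTheory GRing.Theory Num.Theory.
Import numFieldNormedType.Exports.

Local Open Scope classical_set_scope.
Local Open Scope ring_scope.

Section Calculus.
Variables (R : realType) (m : nat).
Implicit Types (f : 'cV[R]_m -> R) (D : set 'cV[R]_m).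

Definition partial (i : 'I_m) f (x : 'cV[R]_m) : R :=
  'D_(delta_mx i 0 : 'cV[R]_m) f x.

Definition grad f (x : 'cV[R]_m) : 'cV[R]_m := \col_i partial i f x.

Definition hess f (x : 'cV[R]_m) : 'M[R]_m :=
  \matrix_(i, j) partial i (partial j f) x.

(* D is meant to be open; functions are total, and only their values on D
   matter. *)
Fixpoint C_on (k : nat) D f : Prop :=
  (forall x, D x -> {for x, continuous f}) /\
  match k with
  | 0%N => True
  | k'.+1 => forall i : 'I_m,
      (forall x, D x -> derivable f x (delta_mx i 0 : 'cV[R]_m)) /\
      C_on k' D (partial i f)
  end.

(* msize is one more than the total degree, and is 0 for the zero polynomial. *)
Definition quadratic_function f : Prop :=
  exists P : mpoly m R,
    (msize P <= 3)%N /\ forall x, f x = meval (fun i => x i 0) P.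

End Calculus.

Section ExtendedPhaseSpace.
Variables (R : realType) (n : nat).

(* Points are z = (q, p), with q = (q_1, ..., q_n, t) and
   p = (p_1, ..., p_n, wp). *)

Implicit Types (z : 'cV[R]_((n + 1) + (n + 1)))
  (F G : 'cV[R]_((n + 1) + (n + 1)) -> R)
  (H : 'cV[R]_(1 + (n + n)) -> R) (D : set 'cV[R]_(1 + (n + n))).

Definition pos z : 'cV[R]_n := usubmx (usubmx z).
Definition time z : 'cV[R]_1 := dsubmx (usubmx z).
Definition mom z : 'cV[R]_n := usubmx (dsubmx z).
Definition wp z : R := dsubmx (dsubmx z) 0 0.

(* (t, q_1, ..., q_n, p_1, ..., p_n) *)
Definition tqp z : 'cV[R]_(1 + (n + n)) :=
  col_mx (time z) (col_mx (pos z) (mom z)).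

Definition ext_ham H z : R := wp z + H (tqp z).

Definition ext_dom D : set 'cV[R]_((n + 1) + (n + 1)) := tqp @^-1` D.

Definition J : 'M[R]_((n + 1) + (n + 1)) :=
  block_mx 0 1%:M (- 1%:M) 0.

Definition poisson F G z : R := ((grad F z)^T *m J *m grad G z) 0 0.

Definition psi F z : R :=
  ((J *m grad F z)^T *m hess F z *m (J *m grad F z)) 0 0.

Definition midpoint (x y : 'cV[R]_((n + 1) + (n + 1))) :
  'cV[R]_((n + 1) + (n + 1)) := 2^-1 *: (y + x).

(* The vertices are z 0, ..., z N; the values of z beyond N, and those of above
   and psik beyond N - 1, are irrelevant.  above k selects the alternative
   psi >= psi_k, mu_k <= 0. *)
Definition regularized_DTH D H (N : nat) (above : nat -> bool)
    (psik : nat -> R) (z : nat -> 'cV[R]_((n + 1) + (n + 1))) : Prop :=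
  forall k : nat, (k < N)%N ->
    let zbar := midpoint (z k) (z k.+1) in
    ext_dom D zbar /\
    exists lambda mu : R,
      [/\ z k.+1 - z k = lambda *: (J *m grad (ext_ham H) zbar)
                         + mu *: (J *m grad (psi (ext_ham H)) zbar),
          ext_ham H zbar = 0,
          (if above k then psik k <= psi (ext_ham H) zbar
           else psi (ext_ham H) zbar <= psik k),
          mu * (psi (ext_ham H) zbar - psik k) = 0
        & (if above k then mu <= 0 else 0 <= mu)].

End ExtendedPhaseSpace.

(* Main.v *)
(* A quadratic L has the midpoint property
   L(y) - L(x) = L_z((x + y) / 2) . (y - x), so along a step of the trajectory
   L changes by lambda [L, H] + mu [L, psi], evaluated at the midpoint, where H
   is the extended Hamiltonian.  It remains to see that [L, psi] = 0.  The field
   w = J L_z is affine, w(z) = c + K z with K = J S and S symmetric, and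
   [L, H] = 0 says that H is invariant along w.  Differentiating w . H_z = 0
   once and twice gives, with A = H_zz,
     (derivative of H_z along w) = - K^T H_z,
     (derivative of A along w)   = - (A K + K^T A).
   As J K^T = - K J, the vector v = J H_z satisfies (derivative of v along w) =
   K v, and the three terms of the derivative of psi = v^T A v cancel. *)
Require Import Defs.
From HB Require Import structures.
From mathcomp Require Import all_boot all_order all_algebra.
From mathcomp Require Import all_classical all_reals all_analysis.
From mathcomp Require Import ring.
From mathcomp Require Import -(notations) mpoly.

Import Order.TTheory GRing.Theory Num.Theory.
Import numFieldNormedType.Exports.

Local Open Scope classical_set_scope.
Local Open Scope ring_scope.

Section DirectionalDerivatives.
Context {R : realType}.

Section AffineSubstitution.
Context {V W : normedModType R} {f : W -> R} {g : V -> W} {x v : V} {w : W}.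
Hypothesis g_affine : forall h : R, g (h *: v + x) = h *: w + g x.

Let growth_rateE :
  (fun h : R => h^-1 *: (((f \o g) \o shift x) (h *: v) - (f \o g) x)) =
  (fun h : R => h^-1 *: ((f \o shift (g x)) (h *: w) - f (g x))).
Proof. by apply/funext => h /=; rewrite g_affine. Qed.

Lemma derive_comp_affine : 'D_v (f \o g) x = 'D_w f (g x).
Proof. by rewrite /derive growth_rateE. Qed.

Lemma derivable_comp_affine : derivable f (g x) w -> derivable (f \o g) x v.
Proof. by rewrite /derivable growth_rateE. Qed.

End AffineSubstitution.

Lemma MVT_direction {V : normedModType R} (f : V -> R) (x v : V) {h : R} :
  0 < h ->
  (forall s, s \in `[0, h] -> derivable f (s *: v + x) v) ->
  exists2 s, s \in `]0, h[ & f (h *: v + x) - f x = h * 'D_v f (s *: v + x).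
Proof.
move=> h0 fv; set l := fun s : R => s *: v + x.
have l_affine s e : l (e *: 1 + s) = e *: v + l s.
  by rewrite /l [e *: 1]mulr1 scalerDl addrA.
have flP s : s \in `[0, h] -> derivable (f \o l) s 1.
  by move=> s0h; apply: (derivable_comp_affine (l_affine s)); exact: fv.
have [||s s0h] := @MVT R (f \o l) (fun s => 'D_v f (l s)) 0 h h0.
- move=> s s0h; rewrite -(derive_comp_affine (l_affine s)).
  by apply/derivableP/flP/subset_itv_oo_cc.
- by apply: derivable_within_continuous => s /flP.
- rewrite subr0 mulrC /= /l scale0r add0r => fE; exists s => //.
Qed.

End DirectionalDerivatives.

Section Clairaut.
Context {R : realType} {m : nat}.
Implicit Types (f : 'cV[R]_m -> R) (D : set 'cV[R]_m).

Local Notation e k := (delta_mx k 0 : 'cV[R]_m).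

Lemma C_on_continuous {k D f x} : C_on k D f -> D x -> {for x, continuous f}.
Proof. by case: k => [|k] [+ _]; apply. Qed.

Lemma C_on_derivable {k D f i x} : C_on k.+1 D f -> D x ->
  derivable f x (delta_mx i 0 : 'cV[R]_m).
Proof. by move=> [_ /(_ i)[+ _]]; apply. Qed.

Lemma C_on_partial {k D f} i : C_on k.+1 D f -> C_on k D (partial i f).
Proof. by move=> [_ /(_ i)[]]. Qed.

Lemma C_onW {k D f} : C_on k.+1 D f -> C_on k D f.
Proof.
elim: k f => [|k IH] f [fc fD]; first by [].
by split=> // i; have [fi /IH] := fD i.
Qed.

Lemma second_difference_MVT {D f} i j x {h : R} : C_on 2 D f -> 0 < h ->
  (forall s t, s \in `[0, h] -> t \in `[0, h] -> D (t *: e j + (s *: e i + x))) ->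
  exists s t, [/\ s \in `]0, h[, t \in `]0, h[ &
    f (h *: e j + (h *: e i + x)) - f (h *: e i + x) - f (h *: e j + x) + f x =
    h ^+ 2 * partial j (partial i f) (t *: e j + (s *: e i + x))].
Proof.
move=> f2 h0 De.
have l0 : 0 \in `[0, h]%R by rewrite in_itv/= lexx ltW.
have lh : h \in `[0, h]%R by rewrite in_itv/= lexx ltW.
pose sh y : 'cV[R]_m := h *: e j + y; pose g := f \o sh - f.
have sh_affine y (t : R) : sh (t *: e i + y) = t *: e i + sh y.
  by rewrite /sh addrCA.
have De0 s : s \in `[0, h] -> D (s *: e i + x).
  by move=> s0h; have := De s 0 s0h l0; rewrite scale0r add0r.
have fd s t : s \in `[0, h] -> t \in `[0, h] ->
    derivable f (t *: e j + (s *: e i + x)) (e i).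
  by move=> s0h t0h; apply: (C_on_derivable f2); exact: De.
have fd0 s : s \in `[0, h] -> derivable f (s *: e i + x) (e i).
  by move=> s0h; apply: (C_on_derivable f2); exact: De0.
have fshd s : s \in `[0, h] -> derivable (f \o sh) (s *: e i + x) (e i).
  by move=> s0h; apply: (derivable_comp_affine (sh_affine _)); exact: fd.
have gd s : s \in `[0, h] -> derivable g (s *: e i + x) (e i).
  by move=> s0h; apply: derivableB; [exact: fshd|exact: fd0].
have [s s0h gE] := MVT_direction g x (e i) h0 gd.
have s0h' : s \in `[0, h]%R by exact: subset_itv_oo_cc.
have [t t0h pE] := MVT_direction (partial i f) (s *: e i + x) (e j) h0
  (fun t th => C_on_derivable (C_on_partial _ f2) (De s t s0h' th)).
exists s, t; split; [exact: s0h|exact: t0h|].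
have dgE : 'D_(e i) g (s *: e i + x) =
    partial i f (h *: e j + (s *: e i + x)) - partial i f (s *: e i + x).
  by rewrite (deriveB (fshd s s0h') (fd0 s s0h')) (derive_comp_affine (sh_affine _)).
rewrite expr2 -mulrA -[partial j _ _]/('D_(e j) _ _) -pE -dgE -gE.
by rewrite /g /sh !fctE /= opprB -[LHS]addrA [- _ + _]addrC.
Qed.

Lemma eq_of_arbitrarily_close_values (p q : 'cV[R]_m -> R) x :
  {for x, continuous p} -> {for x, continuous q} ->
  (forall r, 0 < r -> exists y z, [/\ ball x r y, ball x r z & p y = q z]) ->
  p x = q x.
Proof.
move=> cp cq pq; apply/eqP/negPn/negP => neq.
pose eps := `|p x - q x| / 2.
have eps0 : 0 < eps by rewrite divr_gt0// normr_gt0 subr_eq0.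
move/cvgrPdist_lt/(_ _ eps0)/(nbhs_ballP x): cp => [r1 r10 near_p].
move/cvgrPdist_lt/(_ _ eps0)/(nbhs_ballP x): cq => [r2 r20 near_q].
have [|y [z [xy xz pyqz]]] := pq (Num.min r1 r2); first by rewrite lt_min r10.
have dp : `|p x - p y| < eps.
  by apply: near_p; apply: le_ball xy; rewrite ge_min lexx.
have dq : `|q z - q x| < eps.
  by rewrite distrC; apply: near_q; apply: le_ball xz; rewrite ge_min lexx orbT.
have: `|p x - q x| < eps + eps.
  by apply: le_lt_trans (ltrD dp dq); rewrite -pyqz; exact: ler_distD.
by rewrite -splitr ltxx.
Qed.

Lemma clairaut {D f} i j {x} : open D -> C_on 2 D f -> D x ->
  partial i (partial j f) x = partial j (partial i f) x.
Proof.
move=> D_open f2 Dx.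
apply: eq_of_arbitrarily_close_values.
- exact: (C_on_continuous (C_on_partial _ (C_on_partial _ f2))).
- exact: (C_on_continuous (C_on_partial _ (C_on_partial _ f2))).
move=> r0 r00.
have /(nbhs_ballP x)[r1 r10 ball_D] : nbhs x D by exact: open_nbhs_nbhs.
pose r := Num.min r0 r1.
have r_gt0 : 0 < r by rewrite lt_min r00.
pose h := r / (`|e i| + `|e j| + 1).
have den0 : 0 < `|e i| + `|e j| + 1 by rewrite ltr_wpDl// addr_ge0.
have h0 : 0 < h by rewrite divr_gt0.
have ballP k l s t : `|e k| + `|e l| = `|e i| + `|e j| ->
   s \in `[0, h] -> t \in `[0, h] ->
   ball x r (t *: e l + (s *: e k + x)).
  rewrite !in_itv /= => kl /andP[s0 sh] /andP[t0 th].
  rewrite -ball_normE /= distrC addrA addrK.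
  rewrite (le_lt_trans (ler_normD _ _))// !normrZ !ger0_norm//.
  rewrite (@le_lt_trans _ _ (h * `|e l| + h * `|e k|))//.
    by rewrite lerD// ler_wpM2r.
  rewrite -mulrDr (addrC `|e l|) kl /h mulrAC ltr_pdivrMr//.
  by rewrite ltr_pM2l// ltrDl.
have ball0 y : ball x r y -> ball x r0 y by apply: le_ball; rewrite ge_min lexx.
have ball1 y : ball x r y -> D y.
  by move=> xy; apply: ball_D; apply: le_ball xy; rewrite ge_min lexx orbT.
have [|s [t [sh th E1]]] := second_difference_MVT i j x f2 h0.
  by move=> s t sh th; exact/ball1/(ballP i j s t erefl sh th).
have [|s' [t' [sh' th' E2]]] := second_difference_MVT j i x f2 h0.
  by move=> s1 t1 s1h t1h; exact/ball1/(ballP j i s1 t1 (addrC _ _) s1h t1h).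
exists (t' *: e i + (s' *: e j + x)), (t *: e j + (s *: e i + x)); split.
- by apply/ball0/ballP; [exact: addrC| |]; exact: subset_itv_oo_cc.
- by apply/ball0/ballP => //; exact: subset_itv_oo_cc.
have /mulfI : h ^+ 2 != 0 by rewrite expf_neq0// gt_eqF.
apply; apply: (etrans (esym E2)); apply: (etrans _ E1).
by rewrite addrCA; congr (_ + _); rewrite addrAC.
Qed.

End Clairaut.

Section ClassC.
Context {R : realType}.

Lemma near_eq_continuous {T U : topologicalType} (f g : T -> U) (x : T) :
  {near x, f =1 g} -> {for x, continuous f} -> {for x, continuous g}.
Proof.
move=> fg fx; rewrite /prop_for /continuous_at -(nbhs_singleton fg).
by apply: cvg_trans fx; exact: near_eq_cvg.
Qed.

Lemma eq_on_near {m : nat} {T : Type} {D : set 'cV[R]_m} {f g : 'cV[R]_m -> T} {x} :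
  open D -> {in D, f =1 g} -> D x -> {near x, f =1 g}.
Proof.
move=> D_open fg Dx; have near_D : \forall y \near x, D y by exact: open_nbhs_nbhs.
by apply: filterS near_D => y Dy; apply: fg; rewrite inE.
Qed.

Lemma eq_C_on {m k : nat} {D : set 'cV[R]_m} {f g : 'cV[R]_m -> R} :
  open D -> {in D, f =1 g} -> C_on k D f -> C_on k D g.
Proof.
move=> D_open; elim: k f g => [|k IH] f g fg [fc fD]; (split=> [x Dx|]; first
  by apply: near_eq_continuous (fc x Dx); exact: (eq_on_near D_open fg)).
  by [].
move=> i; have [fi fiC] := fD i; split=> [x Dx|].
  by apply: near_eq_derivable (fi x Dx); exact: (eq_on_near D_open fg).
apply: IH fiC => x; rewrite inE => Dx.
by apply: near_eq_derive; exact: (eq_on_near D_open fg).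
Qed.

Lemma C_on_cst {m : nat} k (D : set 'cV[R]_m) (c : R) : C_on k D (cst c).
Proof.
elim: k c => [|k IH] c; (split; first by move=> x _; exact: cst_continuous).
  by [].
move=> i; split=> [x _|]; first exact: derivable_cst.
have -> : partial i (cst c) = cst 0 by apply/funext => x; exact: derive_cst.
exact: IH.
Qed.

Lemma C_onD {m k : nat} {D : set 'cV[R]_m} {f g : 'cV[R]_m -> R} : open D ->
  C_on k D f -> C_on k D g -> C_on k D (f + g).
Proof.
move=> D_open; elim: k f g => [|k IH] f g [fc fD] [gc gD]; (split=> [x Dx|]; first
  by apply: continuousD; [exact: fc|exact: gc]).
  by [].
move=> i; have [fi fiC] := fD i; have [gi giC] := gD i; split=> [x Dx|].
  by apply: derivableD; [exact: fi|exact: gi].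
apply: (eq_C_on D_open) (IH _ _ fiC giC) => x; rewrite inE => Dx.
by rewrite /partial deriveD//; [exact: fi|exact: gi].
Qed.

Lemma is_derive_coord {m} (i : 'I_m) (x v : 'cV[R]_m) :
  is_derive x v (fun y : 'cV[R]_m => y i 0) (v i 0).
Proof.
have g_affine (h : R) : (h *: v + x) i 0 = h *: v i 0 + x i 0 by rewrite !mxE.
have coordE : (fun y : 'cV[R]_m => y i 0) = id \o (fun y : 'cV[R]_m => y i 0) by [].
rewrite coordE; apply: DeriveDef.
  exact/(derivable_comp_affine g_affine)/derivable_id.
by rewrite (derive_comp_affine g_affine) derive_id.
Qed.

Lemma C_on_coord {m} k (D : set 'cV[R]_m) (i : 'I_m) :
  C_on k D (fun y : 'cV[R]_m => y i 0).
Proof.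
case: k => [|k]; (split; first by move=> x _; exact: coord_continuous).
  by [].
move=> j; split=> [x _|].
  exact: (@ex_derive _ _ _ _ _ _ _ (is_derive_coord i x _)).
have -> : partial j (fun y : 'cV[R]_m => y i 0) =
    cst ((delta_mx j 0 : 'cV[R]_m) i 0).
  by apply/funext => x; exact: (@derive_val _ _ _ _ _ _ _ (is_derive_coord i x _)).
exact: C_on_cst.
Qed.

Lemma linear_cV_continuous {p m} (g : {linear 'cV[R]_p -> 'cV[R]_m}) : continuous g.
Proof.
have -> : (g : 'cV[R]_p -> 'cV[R]_m) =
    (fun x => \sum_(j < p) x j 0 *: g (delta_mx j 0)).
  apply/funext => x; rewrite {1}[x]matrix_sum_delta linear_sum; apply: eq_bigr => j _.
  by rewrite big_ord1 linearZ.
apply: continuous_big => [|j _ x]; first exact: add_continuous.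
exact: (@cvgZr_tmp _ _ _ _ (nbhs_filter x) _ _ _ (@coord_continuous R p 1 j 0 x)).
Qed.

Lemma C_on_comp_linear {p m k} {D : set 'cV[R]_m} {f : 'cV[R]_m -> R}
    (g : {linear 'cV[R]_p -> 'cV[R]_m}) :
  (forall j, g (delta_mx j 0) = 0 \/ exists i, g (delta_mx j 0) = delta_mx i 0) ->
  C_on k D f -> C_on k (g @^-1` D) (f \o g).
Proof.
move=> gd; elim: k f => [|k IH] f [fc fD]; (split=> [x Dx|]; first
  by apply: continuous_comp; [exact: linear_cV_continuous|exact: fc]).
  by [].
have g_affine v x (h : R) : g (h *: v + x) = h *: g v + g x by rewrite linearP.
move=> j; have partialE : partial j (f \o g) = fun x => 'D_(g (delta_mx j 0)) f (g x).
  by apply/funext => x; exact: (derive_comp_affine (g_affine _ x)).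
rewrite partialE; case: (gd j) => [g0|[i gi]].
  split=> [x _|].
    by apply: (derivable_comp_affine (g_affine _ x)); rewrite g0; exact: derivable0.
  rewrite g0 (_ : (fun _ => _) = cst 0); first exact: C_on_cst.
  by apply/funext => x; rewrite derive0.
have [fi fiC] := fD i; split=> [x Dx|].
  by apply: (derivable_comp_affine (g_affine _ x)); rewrite gi; exact: fi.
by rewrite gi; exact: (IH _ fiC).
Qed.

End ClassC.

Section ExtendedHamiltonian.
Context {R : realType} {n : nat}.
Implicit Types (D : set 'cV[R]_(1 + (n + n))) (H : 'cV[R]_(1 + (n + n)) -> R).

Fact tqp_is_linear : linear (@tqp R n).
Proof.
by move=> a x y; rewrite /tqp /time /pos /mom !linearP !scale_col_mx !add_col_mx.
Qed.

HB.instance Definition _ := GRing.isLinear.Build R _ _ _ (@tqp R n) tqp_is_linear.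

Lemma tqp_delta (j : 'I_((n + 1) + (n + 1))) :
  tqp (delta_mx j 0 : 'cV[R]_((n + 1) + (n + 1))) = 0 \/
  exists i, tqp (delta_mx j 0 : 'cV[R]_((n + 1) + (n + 1))) = delta_mx i 0.
Proof.
rewrite /tqp /time /pos /mom; case: (split_ordP j) => a ->.
all: case: (split_ordP a) => b ->; rewrite !(delta_mx_ushift, delta_mx_dshift).
all: rewrite ?(col_mxKu, col_mxKd, linear0, col_mx0).
- by right; exists (rshift 1 (lshift n b)); rewrite delta_mx_dshift delta_mx_ushift.
- by right; exists (lshift (n + n) b); rewrite delta_mx_ushift.
- by right; exists (rshift 1 (rshift n b)); rewrite !delta_mx_dshift.
- by left.
Qed.

Lemma open_ext_dom {D} : open D -> open (ext_dom D).
Proof. by move: D; apply/continuousP/linear_cV_continuous. Qed.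

Lemma C_on_ext_ham k D H : open D -> C_on k D H -> C_on k (ext_dom D) (ext_ham H).
Proof.
move=> D_open HC.
have -> : ext_ham H = (fun z : 'cV[R]_((n + 1) + (n + 1)) =>
    z (rshift _ (rshift _ 0)) 0) + (H \o @tqp R n).
  by apply/funext => z; rewrite /ext_ham /wp !mxE.
apply: (C_onD (open_ext_dom D_open)); first exact: C_on_coord.
by apply: C_on_comp_linear HC; exact: tqp_delta.
Qed.

End ExtendedHamiltonian.

Section LieDerivative.
Context {R : realType} {m : nat}.
Implicit Types (f g : 'cV[R]_m -> R) (D : set 'cV[R]_m) (w x : 'cV[R]_m).

(* Only partial derivatives are used, not Frechet differentiability: for
   functions of class C^k in the sense of C_on this is the derivative along w,
   and the Leibniz rules already hold at this level. *)
Definition is_lie w f x (l : R) : Prop :=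
  (forall k, derivable f x (delta_mx k 0 : 'cV[R]_m)) /\
  \sum_k w k 0 * partial k f x = l.

Lemma is_lie_cst w x (c : R) : is_lie w (cst c) x 0.
Proof.
split=> [k|]; first exact: derivable_cst.
by rewrite big1// => k _; rewrite /partial derive_cst mulr0.
Qed.

Lemma is_lie_coord w x i : is_lie w (fun y => y i 0) x (w i 0).
Proof.
split=> [k|]; first exact: (@ex_derive _ _ _ _ _ _ _ (is_derive_coord i x _)).
have partialE k : partial k (fun y : 'cV[R]_m => y i 0) x = (i == k)%:R.
  rewrite /partial (@derive_val _ _ _ _ _ _ _ (is_derive_coord i x _)).
  by rewrite !mxE eqxx andbT.
under eq_bigr do rewrite partialE.
rewrite (bigD1 i)//= eqxx mulr1 big1 ?addr0// => k ki.
by rewrite eq_sym (negbTE ki) mulr0.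
Qed.

Lemma is_lieD {w x f g a b} : is_lie w f x a -> is_lie w g x b ->
  is_lie w (fun y => f y + g y) x (a + b).
Proof.
move=> [fd <-] [gd <-]; split=> [k|]; first exact: derivableD.
rewrite -big_split; apply: eq_bigr => k _ /=.
by rewrite -mulrDr /partial (deriveD (fd k) (gd k)).
Qed.

Lemma is_lieM {w x f g a b} : is_lie w f x a -> is_lie w g x b ->
  is_lie w (fun y => f y * g y) x (a * g x + f x * b).
Proof.
move=> [fd <-] [gd <-]; split=> [k|]; first exact: derivableM.
rewrite mulr_suml mulr_sumr -big_split; apply: eq_bigr => k _ /=.
rewrite /partial (deriveM (fd k) (gd k)) /GRing.scale /=; ring.
Qed.

Lemma is_lieZ {w x f a} (c : R) : is_lie w f x a ->
  is_lie w (fun y => c * f y) x (c * a).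
Proof.
by move=> /(is_lieM (is_lie_cst w x c)); rewrite mul0r add0r.
Qed.

Lemma is_lie_sum {w x p} {f : 'I_p -> 'cV[R]_m -> R} {a : 'I_p -> R} :
  (forall i, is_lie w (f i) x (a i)) ->
  is_lie w (fun y => \sum_i f i y) x (\sum_i a i).
Proof.
move=> fa; elim: (index_enum _) => [|i s IH].
  rewrite big_nil (_ : (fun _ => _) = cst 0); first exact: is_lie_cst.
  by apply/funext => y; rewrite big_nil.
rewrite big_cons (_ : (fun _ => _) = fun y => f i y + \sum_(j <- s) f j y).
  exact: is_lieD.
by apply/funext => y; rewrite big_cons.
Qed.

Lemma is_lie_C_on w {x k D f} : C_on k.+1 D f -> D x ->
  is_lie w f x (\sum_k w k 0 * partial k f x).
Proof. by move=> fC Dx; split=> // i; exact: C_on_derivable fC Dx. Qed.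

Lemma sum_delta (F : 'I_m -> R) i :
  \sum_k (delta_mx i 0 : 'cV[R]_m) k 0 * F k = F i.
Proof.
rewrite (bigD1 i)//= mxE !eqxx mul1r big1 ?addr0// => k ki.
by rewrite mxE (negbTE ki) mul0r.
Qed.

Lemma is_lie_partial {i x f a} : is_lie (delta_mx i 0) f x a -> partial i f x = a.
Proof. by move=> [_ <-]; rewrite (sum_delta (fun k => partial k f x)). Qed.

Lemma eq_on_partial {D f g} i {x} : open D -> {in D, f =1 g} -> D x ->
  partial i f x = partial i g x.
Proof.
by move=> D_open fg Dx; apply: near_eq_derive; exact: eq_on_near D_open fg Dx.
Qed.

Lemma is_lie_affine w x (c : 'cV[R]_m) (K : 'M[R]_m) a :
  is_lie w (fun y => (c + K *m y) a 0) x ((K *m w) a 0).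
Proof.
have -> : (fun y : 'cV[R]_m => (c + K *m y) a 0) =
    fun y => cst (c a 0) y + \sum_j K a j * y j 0.
  by apply/funext => y; rewrite !mxE.
rewrite mxE -[X in is_lie _ _ _ X]add0r; apply: is_lieD (is_lie_cst _ _ _) _.
by apply: is_lie_sum => j; apply: is_lieZ; exact: is_lie_coord.
Qed.

End LieDerivative.

Section AffineSymmetry.
Context {R : realType} {m : nat}.
Variables (D : set 'cV[R]_m) (F : 'cV[R]_m -> R) (c : 'cV[R]_m) (K : 'M[R]_m).
Hypotheses (D_open : open D) (F_C3 : C_on 3 D F).
Let w x : 'cV[R]_m := c + K *m x.
Hypothesis F_invariant : forall x, D x -> \sum_a w x a 0 * partial a F x = 0.

Let mulmx_delta a i : (K *m (delta_mx i 0 : 'cV[R]_m)) a 0 = K a i.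
Proof. by rewrite -colE mxE. Qed.

Let F1 a : C_on 2 D (partial a F) := C_on_partial _ F_C3.
Let F2 a b : C_on 1 D (partial b (partial a F)) := C_on_partial _ (F1 a).

Let is_lie_cofactor G k i x a : C_on k.+1 D G -> D x ->
  is_lie (delta_mx i 0) (fun y => w y a 0 * G y) x
    (K a i * G x + w x a 0 * partial i G x).
Proof.
move=> G1 Dx; rewrite -mulmx_delta; apply: is_lieM; first exact: is_lie_affine.
by have := is_lie_C_on (delta_mx i 0) G1 Dx; rewrite sum_delta.
Qed.

Lemma first_order_invariance i x : D x ->
  \sum_a (K a i * partial a F x + w x a 0 * partial i (partial a F) x) = 0.
Proof.
move=> Dx; set l := (LHS).
have /is_lie_partial <- : is_lie (delta_mx i 0)
    (fun y => \sum_a w y a 0 * partial a F y) x l.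
  by apply: is_lie_sum => a; exact: is_lie_cofactor (F1 a) Dx.
transitivity (partial i (cst 0 : 'cV[R]_m -> R) x); last exact: derive_cst.
by apply: (eq_on_partial _ D_open _ Dx) => y; rewrite inE => /F_invariant.
Qed.

Lemma second_order_invariance i j x : D x ->
  \sum_a (K a i * partial j (partial a F) x +
   (K a j * partial i (partial a F) x +
    w x a 0 * partial j (partial i (partial a F)) x)) = 0.
Proof.
move=> Dx; set l := (LHS).
have /is_lie_partial <- : is_lie (delta_mx j 0)
    (fun y => \sum_a (K a i * partial a F y + w y a 0 * partial i (partial a F) y)) x l.
  apply: is_lie_sum => a; apply: is_lieD; last exact: is_lie_cofactor (F2 a i) Dx.
  apply: is_lieZ.
  by have := is_lie_C_on (delta_mx j 0) (F1 a) Dx; rewrite sum_delta.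
transitivity (partial j (cst 0 : 'cV[R]_m -> R) x); last exact: derive_cst.
by apply: (eq_on_partial _ D_open _ Dx) => y; rewrite inE => /first_order_invariance.
Qed.

Lemma hess_sym x : D x -> (hess F x)^T = hess F x.
Proof.
by move=> Dx; apply/matrixP => i j; rewrite !mxE (clairaut _ _ D_open (C_onW F_C3) Dx).
Qed.

Lemma lie_grad x : D x ->
  (\col_a \sum_k w x k 0 * partial k (partial a F) x) = - (K^T *m grad F x).
Proof.
move=> Dx; apply/colP => i; have := first_order_invariance i x Dx.
rewrite !mxE big_split/= => /eqP; rewrite addrC addr_eq0 => /eqP E.
under eq_bigr do rewrite (clairaut _ _ D_open (C_onW F_C3) Dx).
by rewrite E; congr (- _); apply: eq_bigr => a _; rewrite !mxE.
Qed.

Lemma lie_hess x : D x ->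
  (\matrix_(i, j) \sum_k w x k 0 * partial k (partial i (partial j F)) x) =
  - (hess F x *m K + (hess F x *m K)^T).
Proof.
move=> Dx; apply/matrixP => i j; have := second_order_invariance j i x Dx.
rewrite !mxE !big_split/= addrA => /eqP; rewrite addrC addr_eq0 => /eqP E.
have third_sym k : partial k (partial i (partial j F)) x =
    partial i (partial j (partial k F)) x.
  rewrite (clairaut _ _ D_open (F1 j) Dx).
  apply: (eq_on_partial _ D_open _ Dx) => y; rewrite inE => Dy.
  exact: (clairaut _ _ D_open (C_onW F_C3) Dy).
under eq_bigr do rewrite third_sym.
by rewrite E; congr (- (_ + _)); apply: eq_bigr => a _; rewrite !mxE mulrC.
Qed.

Lemma is_lie_hess_form (M : 'M[R]_m) x : D x ->
  is_lie (w x)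
    (fun y => ((M *m grad F y)^T *m hess F y *m (M *m grad F y)) 0 0) x
    (let v := M *m grad F x in let dv := - (M *m K^T *m grad F x) in
     (dv^T *m hess F x *m v
      - v^T *m (hess F x *m K + (hess F x *m K)^T) *m v
      + v^T *m hess F x *m dv) 0 0).
Proof.
move=> Dx /=; set v := fun y => M *m grad F y.
have -> : - (M *m K^T *m grad F x) =
    M *m \col_a \sum_k w x k 0 * partial k (partial a F) x.
  by rewrite lie_grad// mulmxN mulmxA.
rewrite -[X in _ + X + _]mulNmx -[X in _ + X *m _ + _]mulmxN -lie_hess//.
set dg := (\col_a _); set dA := (\matrix_(i, j) _).
have vE a : is_lie (w x) (fun y => v y a 0) x ((M *m dg) a 0).
  rewrite (_ : (fun _ => _) = fun y => \sum_b M a b * partial b F y); last first.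
    by apply/funext => y; rewrite mxE; apply: eq_bigr => b _; rewrite mxE.
  rewrite mxE; apply: is_lie_sum => b; apply: is_lieZ; rewrite mxE.
  exact: is_lie_C_on (F1 b) Dx.
have AE a b : is_lie (w x) (fun y => hess F y a b) x (dA a b).
  rewrite (_ : (fun _ => _) = partial a (partial b F)); last first.
    by apply/funext => y; rewrite mxE.
  rewrite mxE; exact: is_lie_C_on (F2 b a) Dx.
rewrite (_ : (fun _ => _) =
    fun y => \sum_b (\sum_a v y a 0 * hess F y a b) * v y b 0); last first.
  apply/funext => y; rewrite mxE; apply: eq_bigr => b _; congr (_ * _).
  by rewrite mxE; apply: eq_bigr => a _; rewrite [_^T _ _]mxE.
rewrite [X in is_lie _ _ _ X](_ : _ = \sum_b
   ((\sum_a ((M *m dg) a 0 * hess F x a b + v x a 0 * dA a b)) * v x b 0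
    + (\sum_a v x a 0 * hess F x a b) * (M *m dg) b 0)); last first.
  rewrite -mulmxDl [LHS]mxE 2![in LHS]mxE -big_split/=; apply: eq_bigr => b _.
  congr (_ * _ + _ * _).
    rewrite mxE 2![in LHS]mxE -big_split/=; apply: eq_bigr => a _.
    by rewrite [_^T _ _]mxE [_^T _ _]mxE.
  by rewrite mxE; apply: eq_bigr => a _; rewrite [_^T _ _]mxE.
apply: is_lie_sum => b; apply: is_lieM; last exact: vE.
by apply: is_lie_sum => a; apply: is_lieM; [exact: vE|exact: AE].
Qed.

End AffineSymmetry.

Lemma addmx11E {R : nmodType} (A B : 'M[R]_1) : (A + B) 0 0 = A 0 0 + B 0 0.
Proof. exact: mxE. Qed.

Lemma oppmx11E {R : zmodType} (A : 'M[R]_1) : (- A) 0 0 = - A 0 0.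
Proof. exact: mxE. Qed.

Lemma scalemx11E {R : pzRingType} (a : R) (A : 'M[R]_1) : (a *: A) 0 0 = a * A 0 0.
Proof. exact: mxE. Qed.

Lemma trmx11E {R : Type} (A : 'M[R]_1) : A^T 0 0 = A 0 0.
Proof. exact: mxE. Qed.

Section QuadraticFunctions.
Context {R : realType} {m : nat}.
Implicit Types (f L : 'cV[R]_m -> R) (x y : 'cV[R]_m).

Definition quad_form (c : R) (b : 'cV[R]_m) (Q : 'M[R]_m) x : R :=
  c + \sum_i b i 0 * x i 0 + \sum_i x i 0 * (\sum_j Q i j * x j 0).

Lemma quad_formE c b Q x :
  quad_form c b Q x = c + (b^T *m x) 0 0 + (x^T *m Q *m x) 0 0.
Proof.
rewrite -mulmxA !mxE; congr (_ + _ + _); apply: eq_bigr => i _; rewrite !mxE //.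
Qed.

Lemma quad_formD c b Q c' b' Q' x :
  quad_form (c + c') (b + b') (Q + Q') x = quad_form c b Q x + quad_form c' b' Q' x.
Proof.
by rewrite !quad_formE linearD/= mulmxDr !mulmxDl !addmx11E; ring.
Qed.

Lemma quad_formZ a c b Q x :
  quad_form (a * c) (a *: b) (a *: Q) x = a * quad_form c b Q x.
Proof.
rewrite !quad_formE linearZ/= -scalemxAr -!scalemxAl !scalemx11E; ring.
Qed.

Lemma mdeg_succP {k} {u : multinom m} : mdeg u = k.+1 ->
  exists i v, u = mnm_add (mnm1 i) v /\ mdeg v = k.
Proof.
move=> uk; have [i ui] : exists i, u i != 0%N.
  apply/existsP; rewrite -negb_forall; apply/negP => /forallP u0.
  by move: uk; rewrite mdegE big1// => i _; exact/eqP/u0.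
exists i, (mnm_sub u (mnm1 i)).
have uE : u = mnm_add (mnm1 i) (mnm_sub u (mnm1 i)).
  by rewrite addmC submK// lep1mP.
split=> //; apply/eqP; rewrite -eqSS -uk {2}uE mdegD mdeg1.
by [].
Qed.

Lemma prod_mnm_add1 i (v : multinom m) x :
  \prod_j x j 0 ^+ (mnm_add (mnm1 i) v) j = x i 0 * \prod_j x j 0 ^+ v j.
Proof.
under eq_bigr do rewrite mnmDE exprD mnm1E.
rewrite big_split/= (bigD1 i)//= eqxx expr1 [X in _ * X * _]big1 ?mulr1// => j ji.
by rewrite eq_sym (negbTE ji).
Qed.

Lemma monomial_quad_form (u : multinom m) : (mdeg u < 3)%N ->
  exists c b Q, forall x, \prod_j x j 0 ^+ u j = quad_form c b Q x.
Proof.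
have degree0 (v : multinom m) : mdeg v = 0%N -> forall x, \prod_j x j 0 ^+ v j = 1.
  by move=> /eqP; rewrite mdeg_eq0 => /eqP-> x; rewrite big1// => j _; rewrite mnm0E.
case uk : (mdeg u) => [|[|[|//]]] _.
- exists 1, 0, 0 => x; rewrite degree0// quad_formE.
  by rewrite linear0 !mul0mx mulmx0 mul0mx !mxE !addr0.
- have [i [v [-> v0]]] := mdeg_succP uk.
  exists 0, (delta_mx i 0), 0 => x; rewrite prod_mnm_add1 degree0// quad_formE.
  by rewrite mulmx0 mul0mx trmx_delta -rowE !mxE mulr1 add0r addr0.
- have [i [v [-> v1]]] := mdeg_succP uk.
  have [j [v' [-> v0]]] := mdeg_succP v1.
  exists 0, 0, (delta_mx i j) => x; rewrite !prod_mnm_add1 degree0// mulr1 /quad_form.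
  rewrite [X in _ + X + _]big1 => [|k _]; last by rewrite mxE mul0r.
  rewrite !add0r (bigD1 i)//= [X in _ + X]big1 => [|k ki].
    rewrite addr0 (bigD1 j)//= big1 => [|k kj]; rewrite mxE.
      by rewrite !eqxx mul1r addr0.
    by rewrite (negbTE kj) andbF mul0r.
  by rewrite big1 ?mulr0// => l _; rewrite mxE (negbTE ki) mul0r.
Qed.

Lemma quadratic_functionP {f} : quadratic_function f ->
  exists c b Q, forall x, f x = quad_form c b Q x.
Proof.
move=> [P [P3 fP]].
have {fP} fE x : f x = \sum_(u <- msupp P) mcoeff u P * \prod_j x j 0 ^+ u j.
  by rewrite fP mevalE.
have deg u : u \in (msupp P : seq _) -> (mdeg u < 3)%N.
  by move=> uP; exact: leq_trans (msize_mdeg_lt uP) P3.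
suff [c [b [Q sE]]] : exists c b Q, forall x,
    \sum_(u <- msupp P) mcoeff u P * \prod_j x j 0 ^+ u j = quad_form c b Q x.
  by exists c, b, Q => x; rewrite fE sE.
elim: (msupp P : seq _) deg {fE} => [_|u s IH deg].
  exists 0, 0, 0 => x; rewrite big_nil quad_formE.
  by rewrite linear0 !mul0mx mulmx0 mul0mx !mxE !addr0.
have [|c [b [Q sE]]] := IH; first by move=> v vs; apply: deg; rewrite inE vs orbT.
have [|c' [b' [Q' uE]]] := monomial_quad_form u; first by apply: deg; rewrite inE eqxx.
exists (mcoeff u P * c' + c), (mcoeff u P *: b' + b), (mcoeff u P *: Q' + Q) => x.
by rewrite big_cons sE uE quad_formD quad_formZ.
Qed.

Lemma grad_quad_form c b Q x : grad (quad_form c b Q) x = b + (Q + Q^T) *m x.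
Proof.
apply/colP => i; rewrite mxE; apply: is_lie_partial.
have bE : is_lie (delta_mx i 0) (fun y => \sum_j b j 0 * y j 0) x
    (\sum_j b j 0 * (delta_mx i 0 : 'cV[R]_m) j 0).
  by apply: is_lie_sum => j; apply: is_lieZ; exact: is_lie_coord.
have QE k : is_lie (delta_mx i 0) (fun y => \sum_j Q k j * y j 0) x
    (\sum_j Q k j * (delta_mx i 0 : 'cV[R]_m) j 0).
  by apply: is_lie_sum => j; apply: is_lieZ; exact: is_lie_coord.
have := is_lieD (is_lieD (is_lie_cst _ _ c) bE)
  (is_lie_sum (fun k => is_lieM (is_lie_coord _ _ k) (QE k))).
congr is_lie.
have deltaE (F : 'I_m -> R) : \sum_j F j * (delta_mx i 0 : 'cV[R]_m) j 0 = F i.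
  by under eq_bigr do rewrite mulrC; rewrite (sum_delta).
under [X in _ + X = _]eq_bigr do rewrite deltaE.
rewrite add0r deltaE big_split/= (sum_delta) mulmxDl !mxE; congr (_ + (_ + _)).
by apply: eq_bigr => j _; rewrite mxE mulrC.
Qed.

Lemma quad_form_midpoint c b Q x y :
  quad_form c b Q y - quad_form c b Q x =
  ((grad (quad_form c b Q) (2^-1 *: (y + x)))^T *m (y - x)) 0 0.
Proof.
rewrite grad_quad_form !quad_formE -scalemxAr.
pose B (u v : 'cV[R]_m) : R := (u^T *m Q *m v) 0 0.
have BT u v : (u^T *m Q^T *m v) 0 0 = B v u.
  by rewrite /B -[RHS]trmx11E !trmx_mul trmxK mulmxA.
have BD u u' v : B (u + u') v = B u v + B u' v.
  by rewrite /B linearD/= !mulmxDl addmx11E.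
have BDr u v v' : B u (v + v') = B u v + B u v' by rewrite /B mulmxDr addmx11E.
have BN u v : B (- u) v = - B u v by rewrite /B linearN/= !mulNmx oppmx11E.
have BNr u v : B u (- v) = - B u v by rewrite /B mulmxN oppmx11E.
have -> : ((b + 2^-1 *: ((Q + Q^T) *m (y + x)))^T *m (y - x)) 0 0 =
    (b^T *m y) 0 0 - (b^T *m x) 0 0 + 2^-1 * (B (y - x) (y + x) + B (y + x) (y - x)).
  have -> : (b + 2^-1 *: ((Q + Q^T) *m (y + x)))^T =
      b^T + 2^-1 *: ((y + x)^T *m Q^T + (y + x)^T *m Q).
    have ST : (Q + Q^T)^T = Q^T + Q by rewrite linearD/= trmxK.
    by rewrite linearD linearZ/= trmx_mul ST mulmxDr.
  rewrite mulmxDl.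
  rewrite -scalemxAl mulmxDl addmx11E scalemx11E addmx11E BT.
  by rewrite mulmxBr addmx11E oppmx11E.
rewrite !(BD, BDr, BN, BNr) -!/(B _ _).
by field.
Qed.

End QuadraticFunctions.

Section PoissonBracket.
Context {R : realType} {n : nat}.
Local Notation m := ((n + 1) + (n + 1))%N.
Implicit Types (D : set 'cV[R]_m) (F G : 'cV[R]_m -> R).

Lemma trmx_J : (J R n)^T = - J R n.
Proof. by rewrite /J tr_block_mx opp_block_mx !raddf0 !raddfN/= trmx1 opprK. Qed.

Lemma poisson_lie F G z :
  poisson F G z = - \sum_k (J R n *m grad F z) k 0 * partial k G z.
Proof.
rewrite /poisson -[(grad F z)^T *m _]trmxK trmx_mul trmxK trmx_J mulNmx linearN/=.
rewrite mulNmx !mxE; congr (- _); apply: eq_bigr => k _.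
by rewrite [_^T _ _]mxE [grad G z _ _]mxE.
Qed.

Lemma poisson_quad_form_psi {D F c b Q} : open D -> C_on 3 D F ->
  (forall z, D z -> poisson (quad_form c b Q) F z = 0) ->
  forall z, D z -> poisson (quad_form c b Q) (psi F) z = 0.
Proof.
move=> D_open F_C3 LF0 z Dz; pose S := Q + Q^T.
have wE y : J R n *m grad (quad_form c b Q) y = J R n *m b + (J R n *m S) *m y.
  by rewrite grad_quad_form mulmxDr mulmxA.
have F_invariant y : D y ->
    \sum_a (J R n *m b + (J R n *m S) *m y) a 0 * partial a F y = 0.
  by move=> /LF0/eqP; rewrite poisson_lie oppr_eq0 wE => /eqP.
have [_] := is_lie_hess_form D F _ _ D_open F_C3 F_invariant (J R n) z Dz.
rewrite poisson_lie wE => ->; apply/eqP; rewrite oppr_eq0; apply/eqP => /=.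
have ST : S^T = S by rewrite /S linearD/= trmxK addrC.
have hT := hess_sym D F D_open F_C3 z Dz.
set A := hess F z; set g := grad F z.
have -> : - (J R n *m (J R n *m S)^T *m g) = J R n *m S *m (J R n *m g).
  by rewrite trmx_mul ST trmx_J !mulmxN mulNmx opprK !mulmxA.
set v := J R n *m g; set K := J R n *m S.
rewrite !trmx_mul hT mulmxDr mulmxDl !mulmxA opprD [- _ - _]addrC addrA subrr.
by rewrite add0r addNr mxE.
Qed.

End PoissonBracket.

Theorem theorem9 (R : realType) (n : nat)
  (D : set 'cV[R]_(1 + (n + n))) (H : 'cV[R]_(1 + (n + n)) -> R)
  (D_open : open D) (H_C3 : C_on 3 D H)
  (L : 'cV[R]_((n + 1) + (n + 1)) -> R)
  (L_quadratic : quadratic_function L)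
  (LH0 : forall z : 'cV[R]_((n + 1) + (n + 1)),
     ext_dom D z -> poisson L (ext_ham H) z = 0)
  (N : nat) (above : nat -> bool) (psik : nat -> R)
  (z : nat -> 'cV[R]_((n + 1) + (n + 1)))
  (z_DTH : regularized_DTH D H N above psik z) :
  forall k : nat, (k < N)%N -> L (z k.+1) = L (z k).
Proof.
move=> k /z_DTH /=; set zbar := midpoint _ _ => -[Dzbar [lambda [mu [dz _ _ _ _]]]].
have [c [b [Q /funext LE]]] := quadratic_functionP L_quadratic; subst L.
apply/eqP; rewrite -subr_eq0 quad_form_midpoint -/(midpoint (z k) (z k.+1)) -/zbar dz.
rewrite mulmxDr -!scalemxAr !mulmxA !addmx11E !scalemx11E.
rewrite -!/(poisson _ _ _) LH0// (poisson_quad_form_psi _ _ LH0)//.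
- by rewrite !mulr0 addr0.
- exact: open_ext_dom.
- exact: C_on_ext_ham.
Qed.
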